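(* Let $(A,\cdot,[\cdot,\cdot])$ be an almost Poisson algebra and $(V,\mu,\rho)$ a representation of it. A linear map $\mathcal{K}:V\to A$ is a relative averaging operator on $(A,\cdot,[\cdot,\cdot])$ with respect to $(V,\mu,\rho)$ if and only if the map $$N_{\mathcal{K}}:A\oplus V\to A\oplus V,\qquad x+u\mapsto\mathcal{K}(u)\quad(x\in A,\ u\in V)$$ is a Nijenhuis operator on the hemisemi-direct product $\mathsf{AWB}$ $A\oplus_{\mu,\rho}V$.
   Context: All vector spaces are finite dimensional over a field $\mathbb{K}$ of characteristic zero. An almost Poisson algebra $(A,\cdot,[\cdot,\cdot])$ is a vector space with a commutative associative bilinear product $\cdot$ and a skew-symmetric bilinear bracket satisfying $[x,y\cdot z]=[x,y]\cdot z+y\cdot[x,z]$ (no Jacobi identity is assumed). A representation $(V,\mu,\rho)$ of it is a vector space $V$ with linear maps $\mu,\rho:A\to\mathrm{End}(V)$ such that $\mu(x\cdot y)=\mu(x)\mu(y)$, $\rho(x\cdot y)=\mu(y)\rho(x)+\mu(x)\rho(y)$ and $\mu([x,y])=\rho(x)\mu(y)-\mu(y)\rho(x)$ for all $x,y\in A$. A relative averaging operator on $(A,\cdot,[\cdot,\cdot])$ with respect to $(V,\mu,\rho)$ is a linear map $\mathcal{K}:V\to A$ such that for all $u,v\in V$: $\mathcal{K}(u)\cdot\mathcal{K}(v)=\mathcal{K}(\mu(\mathcal{K}(u))v)$ and $[\mathcal{K}(u),\mathcal{K}(v)]=\mathcal{K}(\rho(\mathcal{K}(u))v)$. An $\mathsf{AWB}$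 (algebra with bracket) $(B,\cdot,\{\cdot,\cdot\})$ is an associative algebra with a bilinear bracket satisfying $\{x,y\cdot z\}=\{x,y\}\cdot z+y\cdot\{x,z\}$. A Nijenhuis operator on it is a linear map $N:B\to B$ with, for all $x,y\in B$, $$N(x)\cdot N(y)=N\big(N(x)\cdot y+x\cdot N(y)-N(x\cdot y)\big),$$ $$\{N(x),N(y)\}=N\big(\{N(x),y\}+\{x,N(y)\}-N(\{x,y\})\big).$$ The hemisemi-direct product $A\oplus_{\mu,\rho}V$ is the $\mathsf{AWB}$ on $A\oplus V$ with operations $(x+u)\cdot_{A\oplus V}(y+v)=x\cdot y+\mu(x)v$ and $\{x+u,y+v\}_{A\oplus V}=[x,y]+\rho(x)v$ for $x,y\in A$, $u,v\in V$. *)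

(* Defs.v *)
From HB Require Import structures.
From mathcomp Require Import all_boot all_order all_algebra.

Set Implicit Arguments.
Unset Strict Implicit.
Unset Printing Implicit Defensive.

Import GRing.Theory.
Local Open Scope ring_scope.

(* Algebra structures are carried by explicit bilinear maps on a finite
   dimensional space: the products are not assumed unital, so MathComp's ring
   and algebra structures do not apply. *)

Record almost_poisson (F : fieldType) (A : vectType F) := AlmostPoisson {
  ap_mul : {bilinear A -> A -> A};
  ap_bracket : {bilinear A -> A -> A};
  ap_mulC : forall x y, ap_mul x y = ap_mul y x;
  ap_mulA : forall x y z, ap_mul (ap_mul x y) z = ap_mul x (ap_mul y z);
  ap_bracket_skew : forall x y, ap_bracket x y = - ap_bracket y x;
  ap_leibniz : forall x y z,
    ap_bracket x (ap_mul y z) =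
      ap_mul (ap_bracket x y) z + ap_mul y (ap_bracket x z)
}.

Record representation (F : fieldType) (A : vectType F) (P : almost_poisson A)
    (V : vectType F) := Representation {
  rep_mu : {linear A -> 'End(V)};
  rep_rho : {linear A -> 'End(V)};
  rep_muM : forall x y, rep_mu (ap_mul P x y) = (rep_mu x \o rep_mu y)%VF;
  rep_rhoM : forall x y,
    rep_rho (ap_mul P x y) =
      (rep_mu y \o rep_rho x)%VF + (rep_mu x \o rep_rho y)%VF;
  rep_mu_bracket : forall x y,
    rep_mu (ap_bracket P x y) =
      (rep_rho x \o rep_mu y)%VF - (rep_mu y \o rep_rho x)%VF
}.

Definition relative_averaging (F : fieldType) (A : vectType F)
    (P : almost_poisson A) (V : vectType F) (R : representation P V)
    (K : {linear V -> A}) : Prop :=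
  forall u v : V,
    ap_mul P (K u) (K v) = K (rep_mu R (K u) v) /\
    ap_bracket P (K u) (K v) = K (rep_rho R (K u) v).

Record awb (F : fieldType) (B : vectType F) := Awb {
  awb_mul : {bilinear B -> B -> B};
  awb_bracket : {bilinear B -> B -> B};
  awb_mulA : forall x y z, awb_mul (awb_mul x y) z = awb_mul x (awb_mul y z);
  awb_leibniz : forall x y z,
    awb_bracket x (awb_mul y z) =
      awb_mul (awb_bracket x y) z + awb_mul y (awb_bracket x z)
}.

Definition nijenhuis (F : fieldType) (B : vectType F) (S : awb B)
    (N : {linear B -> B}) : Prop :=
  forall x y : B,
    awb_mul S (N x) (N y) =
      N (awb_mul S (N x) y + awb_mul S x (N y) - N (awb_mul S x y)) /\
    awb_bracket S (N x) (N y) =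
      N (awb_bracket S (N x) y + awb_bracket S x (N y) - N (awb_bracket S x y)).

(* The direct sum A (+) V is the product type A * V, with x + u written
   (x, u). *)
Section Hemisemidirect.
Variables (F : fieldType) (A V : vectType F).

(* Common shape of the two operations: (x + u, y + v) |-> m x y + l x v. *)
Definition hemi_op (m : {bilinear A -> A -> A}) (l : {linear A -> 'End(V)})
    (p q : (A * V)%type) : (A * V)%type :=
  (m p.1 q.1, l p.1 q.2).

Fact hemi_op_bilinear (m : {bilinear A -> A -> A}) (l : {linear A -> 'End(V)}) :
  bilinear_for *:%R *:%R (hemi_op m l).
Proof.
split=> q a p p'; rewrite /hemi_op /=; congr pair.
- by rewrite linearPl.
- by rewrite linearP add_lfunE scale_lfunE.
- by rewrite linearPr.
- by rewrite linearP.
Qed.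

HB.instance Definition _ m l :=
  bilinear_isBilinear.Build F (A * V)%type (A * V)%type (A * V)%type _ _
    (hemi_op m l) (hemi_op_bilinear m l).

Variables (P : almost_poisson A) (R : representation P V).

Definition hemi_mul : {bilinear (A * V) -> (A * V) -> (A * V)} :=
  hemi_op (ap_mul P) (rep_mu R).

Definition hemi_bracket : {bilinear (A * V) -> (A * V) -> (A * V)} :=
  hemi_op (ap_bracket P) (rep_rho R).

Fact hemi_mulA p q r : hemi_mul (hemi_mul p q) r = hemi_mul p (hemi_mul q r).
Proof. by congr pair; rewrite /= ?ap_mulA // rep_muM comp_lfunE. Qed.

Fact hemi_leibniz p q r :
  hemi_bracket p (hemi_mul q r) =
    hemi_mul (hemi_bracket p q) r + hemi_mul q (hemi_bracket p r).
Proof.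
congr pair; rewrite /= ?ap_leibniz //.
by rewrite rep_mu_bracket add_lfunE opp_lfunE !comp_lfunE subrK.
Qed.

Definition hemisemidirect : awb (A * V)%type := Awb hemi_mulA hemi_leibniz.

Definition lift_op (K : {linear V -> A}) (p : (A * V)%type) : (A * V)%type :=
  (K p.2, 0).

Fact lift_op_linear (K : {linear V -> A}) : linear (lift_op K).
Proof. by move=> a p q; congr pair; rewrite /= ?linearP // scaler0 addr0. Qed.

HB.instance Definition _ K :=
  GRing.isLinear.Build F (A * V)%type (A * V)%type *:%R (lift_op K)
    (lift_op_linear K).

End Hemisemidirect.

(* Main.v *)
Require Import Defs.
From mathcomp Require Import all_boot all_order all_algebra.

Set Implicit Arguments.
Unset Strict Implicit.
Unset Printing Implicit Defensive.

Import GRing.Theory.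
Local Open Scope ring_scope.

(** Both operations of the hemisemi-direct product send a pair of elements to
    an [A]-part, the operation of [A], and a [V]-part in which the left factor
    acts only through its component in [A]; one computation therefore serves
    for the product and for the bracket. The lifted operator has image in [A]
    and vanishes on [A], so it squares to zero, and it kills every product
    whose right factor lies in its image, since such a product lies in [A].
    Hence the only term that survives on the right of the Nijenhuis identity
    at [(x, u)], [(y, v)] is [K (l (K u) v)], with [l] being [mu] or [rho],
    whatever [x] and [y] are: the identity is the averaging identity at [u],
    [v] ([lift_op_nijenhuisE]). *)

(** On the right-hand side only the second component of the argument of
    [lift_op K] matters. There the term [hemi_op m l p (lift_op K q)]
    contributes [l p.1 0 = 0], and the square of [lift_op K] contributes [0]. *)
Lemma lift_op_nijenhuisE (F : fieldType) (A V : vectType F)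
    (m : {bilinear A -> A -> A}) (l : {linear A -> 'End(V)})
    (K : {linear V -> A}) (p q : (A * V)%type) :
  hemi_op m l (lift_op K p) (lift_op K q) =
    lift_op K (hemi_op m l (lift_op K p) q + hemi_op m l p (lift_op K q)
               - lift_op K (hemi_op m l p q)) <->
  m (K p.2) (K q.2) = K (l (K p.2) q.2).
Proof.
by rewrite /lift_op /hemi_op /= !linear0 !addr0; split=> [[]|->].
Qed.

Theorem proposition5p18 (F : fieldType) (charF0 : [pchar F] =i pred0)
    (A V : vectType F) (P : almost_poisson A) (R : representation P V)
    (K : {linear V -> A}) :
  relative_averaging R K <-> nijenhuis (hemisemidirect R) (lift_op K).
Proof.
split=> [avgK p q | nijK u v].
  by have [mulK brK] := avgK p.2 q.2; split; apply/lift_op_nijenhuisE.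
have [mulK brK] := nijK (0, u) (0, v).
by split; [move/lift_op_nijenhuisE: mulK | move/lift_op_nijenhuisE: brK].
Qed.
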